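(* If $T$ is a non-trivial subdivision tree over $S_3$ (that is, in the case of the monoid $M_3$), then $N(T)=[m,M]\cap\mathbb{Z}$, where $m=\min(N(T))$ and $M=\max(N(T))$.
   Context: Let $I=[0,1)$; $A:I\to[0,1/2)$, $A(x)=\frac{x}{x+1}$; $B:I\to[1/2,1)$, $B(x)=\frac1{2-x}$; $C=C_3:I\to I$, $C(x)=\frac{3x}{2x+1}$. A subdivision tree is a finite rooted binary tree, each vertex of which is either a leaf (no children) or a node (having a left child and a right child), together with a label in $\mathbb{Z}$ on each node. The trivial subdivision tree consists of a single vertex, which is a leaf. Each leaf $\ell$ is labelled by a word: if the path from the root to $\ell$ passes through nodes with labels $n_1,\dots,n_k$ (in order, starting at the root) and $X_j=A$ (resp. $X_j=B$) if the path goes from the $j$-th node to its left (resp. right) child, then the label of $\ell$ is $C^{n_1}X_1C^{n_2}X_2\cdots C^{n_k}X_k$. As a tree over $S_3$, the tree represents the collection of intervals $\omega\cdot[0,1)$, where $\omega$ ranges over the leaf labels, read as compositions of functions (rightmost applied first); this is a partition of $[0,1)$. Two subdivision trees are equivalent, $T_1\approx T_2$, if they represent the same collection of intervals. For non-trivial $T$, $n(T)$ is the integer label of the root, and $N(T)=\{n(T')\mid T'\approx T\}$ (a finite set). *)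

(* Defs.v *)
From HB Require Import structures.
From mathcomp Require Import all_boot all_order all_algebra.
From mathcomp Require Import boolp classical_sets reals.
From mathcomp Require Import ring lra.

Set Implicit Arguments.
Unset Strict Implicit.
Unset Printing Implicit Defensive.

Import Order.TTheory GRing.Theory Num.Theory.

Local Open Scope classical_set_scope.
Local Open Scope ring_scope.

(* The maps are total functions R -> R that are only ever applied to points   *)
(* of the interval I = [0, 1).                                                *)
Section Maps.
Variable R : realType.
Implicit Types x : R.

Definition I01 : set R := [set x | 0 <= x < 1].

Definition mapA x : R := x / (x + 1).
Definition mapB x : R := 1 / (2 - x).
Definition mapC x : R := 3 * x / (2 * x + 1).
Definition mapCinv x : R := x / (3 - 2 * x).

Lemma mapC_I01 x : I01 x -> I01 (mapC x).
Proof.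
move=> /= /andP[x0 x1]; have d0 : 0 < 2 * x + 1 by lra.
by rewrite /I01 /mapC /= divr_ge0 ?ltr_pdivrMr //; lra.
Qed.

Lemma mapCinv_I01 x : I01 x -> I01 (mapCinv x).
Proof.
move=> /= /andP[x0 x1]; have d0 : 0 < 3 - 2 * x by lra.
by rewrite /I01 /mapCinv /= divr_ge0 ?ltr_pdivrMr //; lra.
Qed.

Lemma mapCK x : I01 x -> mapCinv (mapC x) = x.
Proof.
move=> /= /andP[x0 x1]; rewrite /mapCinv /mapC; field.
by apply/andP; split; apply/eqP; lra.
Qed.

Lemma mapCinvK x : I01 x -> mapC (mapCinv x) = x.
Proof.
move=> /= /andP[x0 x1]; rewrite /mapCinv /mapC; field.
by apply/andP; split; apply/eqP; lra.
Qed.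

(* [Negz k] is the integer -(k + 1). *)
Definition mapCpow (n : int) : R -> R :=
  match n with
  | Posz k => iter k mapC
  | Negz k => iter k.+1 mapCinv
  end.

End Maps.

Arguments I01 R : clear implicits.

(* [:: (n_1, b_1); ...; (n_k, b_k)] stands for C^n_1 X_1 ... C^n_k X_k, where *)
(* X_j is A if b_j is true and B if b_j is false.                             *)
Definition word := seq (int * bool).

Inductive subdivision_tree :=
  | Leaf
  | Node of int & subdivision_tree & subdivision_tree.

Fixpoint leaf_labels (T : subdivision_tree) : seq word :=
  match T with
  | Leaf => [:: [::]]
  | Node n L R =>
      [seq (n, true) :: w | w <- leaf_labels L] ++
      [seq (n, false) :: w | w <- leaf_labels R]
  end.

Definition root_label (T : subdivision_tree) : option int :=
  if T is Node n _ _ then Some n else None.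

Section Represent.
Variable R : realType.

Fixpoint word_map (w : word) : R -> R :=
  match w with
  | [::] => id
  | (n, b) :: w' => mapCpow n \o (if b then @mapA R else @mapB R) \o word_map w'
  end.

Definition intervals (T : subdivision_tree) : set (set R) :=
  [set J | exists2 w, w \in leaf_labels T & J = word_map w @` I01 R].

Definition tree_equiv (T1 T2 : subdivision_tree) : Prop :=
  intervals T1 = intervals T2.

Definition root_labels (T : subdivision_tree) : set int :=
  [set n | exists T', tree_equiv T' T /\ root_label T' = Some n].

End Represent.

(* Main.v *)
(* In the coordinate t = x / (1 - x) the maps A, B, C become t / (t + 1),     *)
(* t + 1, 3 t on [0, oo).  Write a point p / q of [0, oo] as the primitive    *)
(* vector (p, q), and call two points adjacent if their determinant is a      *)
(* power 3 ^ k; k is the exponent of the edge.  A subdivision tree is then    *)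
(* the same as a triangulation, by such edges, of the polygon whose vertices  *)
(* are 0, oo and the division points, and the root label is the n for which   *)
(* 3 ^ n is the apex over the edge (0, oo).                                   *)
(*   In a triangle the smallest exponent occurs twice.  Hence, if (u, v) has  *)
(* maximal exponent among all edges of a triangulation, then the apexes over  *)
(* (u, v) are proportional to u + v and u - v.  Given two triangulations of   *)
(* the same polygon, let M be the maximal exponent in both.  If (0, oo) has   *)
(* exponent M, the root labels agree.  If another side of the polygon has     *)
(* exponent M, both triangulations have the same triangle on it, which can be *)
(* cut off.  Otherwise one of them has an inner triangle with three sides of  *)
(* exponent M, and its three neighbours complete it to a hexagon that has a   *)
(* second triangulation, of smaller total exponent; exchanging the two        *)
(* changes the root label by at most 1.  By induction every integer between   *)
(* the two root labels is the root label of a triangulation of the polygon.   *)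

Require Import Defs.
From HB Require Import structures.
From mathcomp Require Import all_boot all_order all_algebra.
From mathcomp Require Import boolp classical_sets reals.
From mathcomp Require Import ring lra zify.

Set Implicit Arguments.
Unset Strict Implicit.
Unset Printing Implicit Defensive.
Import Order.TTheory GRing.Theory Num.Theory.

Local Open Scope classical_set_scope.
Local Open Scope ring_scope.

(** * Vectors, edges and triangles *)

(** Why the outline above works. By [cramer], a triangle gives a relation 3^a w = 3^b u + 3^c v in
    the exponents of its edges. A strictly smallest exponent would make a primitive vector divisible
    by 3, so the smallest one is repeated. Hence the third vertex on an edge of maximal exponent is
    forced on either side, the powers of 3 being removed by [prim_vec_scale_eq].

    This drives [labels_between], an induction on the total weight of two triangulations plus the
    number of division points. A maximal base edge forces equal root labels, a maximal side is cut
    off ([cut_common]) and glued back ([graft]), and a maximal inner edge allows a hexagon exchange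
    ([bounded_pred_or_move]).

    The link with trees is that a prefix of a word acts as t -> u + lam t v: [C] multiplies lam by
    3, while [A] and [B] pass to the two lower edges of the triangle with apex u + lam v
    ([intervals_tree_of]). So equivalent trees are the triangulations with the same vertices
    ([tree_equiv_inorder], [root_labelsE]). The root apex is one of finitely many division points,
    so extreme labels exist, and [labels_between] fills the gap. *)

Definition vec := (int * int)%type.

(** The sign makes [det u v] positive when u.1 / u.2 < v.1 / v.2, so an [edge] runs from left to
    right. *)
Definition det (u v : vec) : int := v.1 * u.2 - v.2 * u.1.

Definition prim_vec (u : vec) := [&& 0 <= u.1, 0 <= u.2 & coprimez u.1 u.2].

Definition expo (u v : vec) : nat := logn 3 `|det u v|%N.

Definition edge (u v : vec) := det u v == 3 ^+ expo u v.

Lemma expo_edge u v k : det u v = 3 ^+ k -> expo u v = k.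
Proof. by move=> h; rewrite /expo h abszX (pfactorK k (isT : prime 3)). Qed.

Lemma edge_det u v k : det u v = 3 ^+ k -> edge u v.
Proof. by move=> h; rewrite /edge (expo_edge h) h. Qed.

Lemma det_edge u v : edge u v -> det u v = 3 ^+ expo u v.
Proof. by move/eqP. Qed.

Lemma prim_vec_not3 u : prim_vec u -> (3 %| u.1)%Z -> (3 %| u.2)%Z -> False.
Proof.
case/and3P=> _ _ cop d1 d2.
have : (3 %| gcdz u.1 u.2)%Z by rewrite dvdz_gcd d1 d2.
by rewrite (eqP cop).
Qed.

Lemma expr3_neq0 k : (3 : int) ^+ k != 0.
Proof. exact: expf_neq0. Qed.

Lemma expr3_mulI k : injective ( *%R ((3 : int) ^+ k)).
Proof. exact/mulfI/expr3_neq0. Qed.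

Lemma expr3_split i j : (i <= j)%N -> (3 : int) ^+ j = 3 ^+ i * 3 ^+ (j - i).
Proof. by move=> le_ij; rewrite -exprD subnKC. Qed.

Lemma expr3_dvd k : (0 < k)%N -> (3 %| (3 : int) ^+ k)%Z.
Proof. by case: k => // k _; rewrite exprS dvdz_mulr. Qed.

Lemma dvd3_lowest (i j k : nat) (x y z : int) : (i < j)%N -> (i < k)%N ->
  3 ^+ i * x = 3 ^+ j * y + 3 ^+ k * z -> (3 %| x)%Z.
Proof.
move=> ij ik; rewrite (expr3_split (ltnW ij)) (expr3_split (ltnW ik)) -!mulrA.
rewrite -mulrDr => /expr3_mulI ->.
by rewrite rpredD ?dvdz_mulr // expr3_dvd // subn_gt0.
Qed.

Lemma expr3_cancel (n m : nat) (x : int) :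
  3 ^+ n * x = 3 ^+ m -> (n <= m)%N /\ x = 3 ^+ (m - n).
Proof.
move=> h; have le_nm : (n <= m)%N.
  have : (3 ^ n %| 3 ^ m)%N.
    by have /(congr1 absz) := h; rewrite abszM !abszX => <-; apply: dvdn_mulr.
  by rewrite dvdn_Pexp2l.
by split=> //; move: h; rewrite (expr3_split le_nm) => /expr3_mulI.
Qed.

Lemma dvd3_of_sum_diff (a b : int) :
  (3 %| b - a)%Z -> (3 %| a + b)%Z -> (3 %| a)%Z.
Proof. lia. Qed.

Lemma dvd3_double_left (a b : int) : (3 %| b - a)%Z -> (3 %| 2 * a + b)%Z.
Proof. lia. Qed.

Lemma dvd3_double_right (a b : int) : (3 %| b - a)%Z -> (3 %| a + 2 * b)%Z.
Proof. lia. Qed.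

Lemma cramer (u w v : vec) :
  det u v * w.1 = det w v * u.1 + det u w * v.1 /\
  det u v * w.2 = det w v * u.2 + det u w * v.2.
Proof. by rewrite /det; split; ring. Qed.

Section Triangle.
Variables u w v : vec.
Hypotheses (gu : prim_vec u) (gw : prim_vec w) (gv : prim_vec v).
Hypotheses (euw : edge u w) (ewv : edge w v) (euv : edge u v).

Let rel1 : 3 ^+ expo u v * w.1 = 3 ^+ expo w v * u.1 + 3 ^+ expo u w * v.1.
Proof. by rewrite -!det_edge //; have [] := cramer u w v. Qed.

Let rel2 : 3 ^+ expo u v * w.2 = 3 ^+ expo w v * u.2 + 3 ^+ expo u w * v.2.
Proof. by rewrite -!det_edge //; have [] := cramer u w v. Qed.

Let min_w : (expo u v < expo w v)%N -> (expo u v < expo u w)%N -> False.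
Proof.
move=> h1 h2; apply: (prim_vec_not3 gw).
  exact: dvd3_lowest h1 h2 rel1.
exact: dvd3_lowest h1 h2 rel2.
Qed.

Let min_u : (expo w v < expo u v)%N -> (expo w v < expo u w)%N -> False.
Proof.
move=> h1 h2; apply: (prim_vec_not3 gu).
  by apply: (@dvd3_lowest _ _ _ _ w.1 (- v.1) h1 h2); rewrite mulrN rel1; ring.
by apply: (@dvd3_lowest _ _ _ _ w.2 (- v.2) h1 h2); rewrite mulrN rel2; ring.
Qed.

Let min_v : (expo u w < expo u v)%N -> (expo u w < expo w v)%N -> False.
Proof.
move=> h1 h2; apply: (prim_vec_not3 gv).
  by apply: (@dvd3_lowest _ _ _ _ w.1 (- u.1) h1 h2); rewrite mulrN rel1; ring.
by apply: (@dvd3_lowest _ _ _ _ w.2 (- u.2) h1 h2); rewrite mulrN rel2; ring.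
Qed.

(** With the base maximal, the repeated smallest exponent must be that of the two lower edges, and
    it cancels from [cramer]. The two outer variants below have a lower edge as the maximal one. *)
Lemma apex_inner :
  (expo u w <= expo u v)%N -> (expo w v <= expo u v)%N ->
  [/\ expo u w = expo w v,
      u.1 + v.1 = 3 ^+ (expo u v - expo u w) * w.1 &
      u.2 + v.2 = 3 ^+ (expo u v - expo u w) * w.2].
Proof.
move=> h1 h2; have e : expo u w = expo w v by lia.
split=> //; apply: (@expr3_mulI (expo u w)); rewrite mulrA -expr3_split //.
  by rewrite rel1 e mulrDr.
by rewrite rel2 e mulrDr.
Qed.

Lemma apex_outer_right :
  (expo w v <= expo u w)%N -> (expo u v <= expo u w)%N ->
  [/\ expo w v = expo u v,
      w.1 - u.1 = 3 ^+ (expo u w - expo u v) * v.1 &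
      w.2 - u.2 = 3 ^+ (expo u w - expo u v) * v.2].
Proof.
move=> h1 h2; have e : expo w v = expo u v by lia.
split=> //; apply: (@expr3_mulI (expo u v)); rewrite mulrA -expr3_split //.
  by rewrite mulrBr rel1 e; ring.
by rewrite mulrBr rel2 e; ring.
Qed.

Lemma apex_outer_left :
  (expo u w <= expo w v)%N -> (expo u v <= expo w v)%N ->
  [/\ expo u w = expo u v,
      w.1 - v.1 = 3 ^+ (expo w v - expo u v) * u.1 &
      w.2 - v.2 = 3 ^+ (expo w v - expo u v) * u.2].
Proof.
move=> h1 h2; have e : expo u w = expo u v by lia.
split=> //; apply: (@expr3_mulI (expo u v)); rewrite mulrA -expr3_split //.
  by rewrite mulrBr rel1 e; ring.
by rewrite mulrBr rel2 e; ring.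
Qed.

End Triangle.

Lemma prim_vec_scale_eq (x y : vec) (i j : nat) : prim_vec x -> prim_vec y ->
  3 ^+ i * x.1 = 3 ^+ j * y.1 -> 3 ^+ i * x.2 = 3 ^+ j * y.2 -> x = y.
Proof.
wlog le_ij : x y i j / (i <= j)%N => [wl gx gy e1 e2|gx gy].
  case: (leqP i j) => [le_ij|/ltnW le_ji]; first exact: (wl x y i j).
  by apply/esym/(wl y x j i).
rewrite (expr3_split le_ij) -!mulrA => /expr3_mulI e1 /expr3_mulI e2.
have [e|lt0] := posnP (j - i).
  by rewrite e !mul1r in e1 e2; rewrite (surjective_pairing x) e1 e2; case: (y).
case: (prim_vec_not3 gx); first by rewrite e1 dvdz_mulr ?expr3_dvd.
by rewrite e2 dvdz_mulr ?expr3_dvd.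
Qed.

(** * The hexagon around a triangle with three maximal sides *)

Section Hexagon.
Variables p q z : vec.
Let M := expo p q.
Hypotheses (gp : prim_vec p) (gq : prim_vec q) (gz : prim_vec z).
Hypotheses (epq : edge p q) (epz : edge p z) (ezq : edge z q).
Hypotheses (mpz : (expo p z <= M)%N) (mzq : (expo z q <= M)%N).
Hypotheses (c1 : (3 %| q.1 - p.1)%Z) (c2 : (3 %| q.2 - p.2)%Z).

(** Since p and q agree modulo 3, p + q is congruent to 2 p, which is not divisible by 3; so no
    power of 3 can be removed from p + q. *)
Lemma hexagon_center :
  [/\ expo p z = M, expo z q = M, z.1 = p.1 + q.1 & z.2 = p.2 + q.2].
Proof.
have [e e1 e2] := apex_inner gp gz gq epz ezq epq mpz mzq.
have eM : expo p z = M.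
  have [//|lt] := eqVneq (expo p z) M.
  have lt0 : (0 < expo p q - expo p z)%N by rewrite subn_gt0 ltn_neqAle lt.
  have d3 := expr3_dvd lt0.
  have d1 : (3 %| p.1 + q.1)%Z by rewrite e1 dvdz_mulr.
  have d2 : (3 %| p.2 + q.2)%Z by rewrite e2 dvdz_mulr.
  by case: (prim_vec_not3 gp (dvd3_of_sum_diff c1 d1) (dvd3_of_sum_diff c2 d2)).
by rewrite -e e1 e2 eM subnn !mul1r.
Qed.

(** Here p + z = 2 p + q is congruent to 3 p, so a factor 3 does come off and the ear has lower
    edges below M. *)
Lemma hexagon_ear_left x :
  prim_vec x -> edge p x -> edge x z ->
  (expo p x <= M)%N -> (expo x z <= M)%N ->
  [/\ (expo p x < M)%N, 2 * p.1 + q.1 = 3 ^+ (M - expo p x) * x.1 &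
      2 * p.2 + q.2 = 3 ^+ (M - expo p x) * x.2].
Proof.
move=> gx epx exz m1 m2; have [e _ z1 z2] := hexagon_center.
rewrite -e in m1 m2; have [_] := apex_inner gp gx gz epx exz epz m1 m2.
rewrite e z1 z2 (_ : p.1 + (p.1 + q.1) = 2 * p.1 + q.1); last by ring.
rewrite (_ : p.2 + (p.2 + q.2) = 2 * p.2 + q.2); last by ring.
move=> h1 h2; split=> //; rewrite ltn_neqAle -{2}e m1 andbT; apply/negP=> /eqP ex.
rewrite ex subnn !mul1r in h1 h2.
by case: (prim_vec_not3 gx); rewrite -?h1 -?h2 dvd3_double_left.
Qed.

Lemma hexagon_ear_right y :
  prim_vec y -> edge z y -> edge y q ->
  (expo z y <= M)%N -> (expo y q <= M)%N ->
  [/\ (expo y q < M)%N, p.1 + 2 * q.1 = 3 ^+ (M - expo y q) * y.1 &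
      p.2 + 2 * q.2 = 3 ^+ (M - expo y q) * y.2].
Proof.
move=> gy ezy eyq m1 m2; have [_ e z1 z2] := hexagon_center.
rewrite -e in m1 m2; have [e'] := apex_inner gz gy gq ezy eyq ezq m1 m2.
rewrite e' e z1 z2 (_ : p.1 + q.1 + q.1 = p.1 + 2 * q.1); last by ring.
rewrite (_ : p.2 + q.2 + q.2 = p.2 + 2 * q.2); last by ring.
move=> h1 h2; split=> //; rewrite ltn_neqAle -{2}e m2 andbT; apply/negP=> /eqP ey.
rewrite ey subnn !mul1r in h1 h2.
by case: (prim_vec_not3 gy); rewrite -?h1 -?h2 dvd3_double_right.
Qed.

End Hexagon.

Lemma edge_scaled (M i j : nat) (x y a b : vec) :
  3 ^+ i * x.1 = a.1 -> 3 ^+ i * x.2 = a.2 ->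
  3 ^+ j * y.1 = b.1 -> 3 ^+ j * y.2 = b.2 ->
  det a b = 3 ^+ M ->
  [/\ (i + j <= M)%N, edge x y & expo x y = (M - (i + j))%N].
Proof.
move=> a1 a2 b1 b2 h.
have /expr3_cancel [le e] : 3 ^+ (i + j) * det x y = 3 ^+ M.
  by rewrite -h /det -a1 -a2 -b1 -b2 exprD; ring.
by split=> //; [exact: edge_det e | exact: expo_edge e].
Qed.

(** * Triangulated polygons *)

(** The base edge (u, v) is not stored but passed along: [Tri w l r] has apex w over it, with l on
    (u, w) and r on (w, v). *)
Inductive triangulation := Side | Tri of vec & triangulation & triangulation.

(** Together with the base vertices this lists the vertices of the polygon; a side is addressed by a
    splitting [l1 ++ l2] of this list. *)
Fixpoint inorder b : seq vec :=
  if b is Tri w l r then inorder l ++ w :: inorder r else [::].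

Fixpoint valid (u v : vec) b : bool :=
  edge u v &&
  (if b is Tri w l r then [&& prim_vec w, valid u w l & valid w v r] else true).

Fixpoint bounded (M : nat) (u v : vec) b : bool :=
  (expo u v <= M)%N &&
  (if b is Tri w l r then bounded M u w l && bounded M w v r else true).

Fixpoint sides_lt (M : nat) (u v : vec) b : bool :=
  if b is Tri w l r then sides_lt M u w l && sides_lt M w v r
  else (expo u v < M)%N.

Fixpoint weight (u v : vec) b : nat :=
  (expo u v +
   (if b is Tri w l r then weight u w l + weight w v r else 0))%N.

(** By [cramer], w is proportional to u + 3^m v with m this label. *)
Definition apex_label (u w v : vec) : int := (expo u w)%:Z - (expo w v)%:Z.

Definition root_apex_label (u v : vec) b : int :=
  if b is Tri w _ _ then apex_label u w v else 0.

Lemma valid_edge u v b : valid u v b -> edge u v.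
Proof. by case: b => [|w l r] /andP[]. Qed.

Lemma bounded_root M u v b : bounded M u v b -> (expo u v <= M)%N.
Proof. by case: b => [|w l r] /andP[]. Qed.

Lemma expr3_gt0 k : 0 < (3 : int) ^+ k.
Proof. exact: exprn_gt0. Qed.

(** The vectors 2 p + q, p + 2 q and q - p have pairwise determinants 3 det p q up to sign, so each
    new exponent is M + 1 minus the powers of 3 taken out of the two ends. The two cases put r to
    the right of q or to the left of p. *)
Lemma hexagon_edges p q x y r :
  let M := expo p q in let i := expo p x in let j := expo y q in
  edge p q -> (i < M)%N -> (j < M)%N ->
  2 * p.1 + q.1 = 3 ^+ (M - i) * x.1 -> 2 * p.2 + q.2 = 3 ^+ (M - i) * x.2 ->
  p.1 + 2 * q.1 = 3 ^+ (M - j) * y.1 -> p.2 + 2 * q.2 = 3 ^+ (M - j) * y.2 ->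
  [/\ edge x y, (expo x y < M)%N &
   forall s, (0 < s)%N ->
     (q.1 - p.1 = 3 ^+ s * r.1 -> q.2 - p.2 = 3 ^+ s * r.2 ->
      [/\ edge x r, edge y r, (expo x r + s = i.+1)%N & (expo y r + s = j.+1)%N]) /\
     (p.1 - q.1 = 3 ^+ s * r.1 -> p.2 - q.2 = 3 ^+ s * r.2 ->
      [/\ edge r x, edge r y, (expo r x + s = i.+1)%N & (expo r y + s = j.+1)%N])].
Proof.
move=> M i j epq iM jM x1 x2 y1 y2.
have dpq := det_edge epq; rewrite -/M /det in dpq.
have d3 : 3 ^+ M.+1 = 3 * (q.1 * p.2 - q.2 * p.1) by rewrite dpq exprS.
have [|le exy nxy] := @edge_scaled M.+1 (M - i) (M - j) x y
  (2 * p.1 + q.1, 2 * p.2 + q.2) (p.1 + 2 * q.1, p.2 + 2 * q.2)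
  (esym x1) (esym x2) (esym y1) (esym y2).
  by rewrite d3 /det /=; ring.
split=> //; first by rewrite nxy; lia.
move=> s s0; split=> r1 r2.
  have [|le1 exr nxr] := @edge_scaled M.+1 (M - i) s x r
    (2 * p.1 + q.1, 2 * p.2 + q.2) (q.1 - p.1, q.2 - p.2)
    (esym x1) (esym x2) (esym r1) (esym r2).
    by rewrite d3 /det /=; ring.
  have [|le2 eyr nyr] := @edge_scaled M.+1 (M - j) s y r
    (p.1 + 2 * q.1, p.2 + 2 * q.2) (q.1 - p.1, q.2 - p.2)
    (esym y1) (esym y2) (esym r1) (esym r2).
    by rewrite d3 /det /=; ring.
  by split=> //; rewrite ?nxr ?nyr; lia.
have [|le1 exr nxr] := @edge_scaled M.+1 s (M - i) r x
  (p.1 - q.1, p.2 - q.2) (2 * p.1 + q.1, 2 * p.2 + q.2)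
  (esym r1) (esym r2) (esym x1) (esym x2).
  by rewrite d3 /det /=; ring.
have [|le2 eyr nyr] := @edge_scaled M.+1 s (M - j) r y
  (p.1 - q.1, p.2 - q.2) (p.1 + 2 * q.1, p.2 + 2 * q.2)
  (esym r1) (esym r2) (esym y1) (esym y2).
  by rewrite d3 /det /=; ring.
by split=> //; rewrite ?nxr ?nyr; lia.
Qed.

Lemma dvd3_scaled s (a b c : int) :
  (0 < s)%N -> a - b = 3 ^+ s * c -> (3 %| a - b)%Z.
Proof. by move=> s0 ->; rewrite dvdz_mulr ?expr3_dvd. Qed.

Lemma dvdzBC (a b : int) : (3 %| a - b)%Z -> (3 %| b - a)%Z.
Proof. by rewrite -opprB rpredN. Qed.

(* The central triangle (u, z, q) has three sides of maximal exponent M and   *)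
(* is replaced, together with its three neighbours, by four triangles around  *)
(* (x, y, r), in which u, z, q have become ears.                              *)
Lemma hexagon_move_left M u q r z x y A B C D E :
  let b := Tri q (Tri z (Tri x A B) (Tri y C D)) E in
  let b1 := Tri x A (Tri y (Tri z B C) (Tri q D E)) in
  prim_vec u -> prim_vec r -> valid u r b -> bounded M u r b ->
  expo u q = M -> expo u z = M -> expo z q = M -> (expo u r < M)%N ->
  [/\ valid u r b1, (weight u r b1 < weight u r b)%N &
      root_apex_label u r b1 = root_apex_label u r b - 1].
Proof.
move=> b b1 gu gr /=.
case/and4P=> eur gq /and4P[euq gz vl vr] vE.
case/and4P: vl => euz gx vA vB; case/and4P: vr => ezq gy vC vD.
case/and3P=> _ /and3P[_ bl br] bE muq muz mzq lt.
case/and3P: bl => _ bA bB; case/and3P: br => _ bC bD.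
have eux := valid_edge vA; have exz := valid_edge vB.
have ezy := valid_edge vC; have eyq := valid_edge vD; have eqr := valid_edge vE.
have [nqr d1 d2] : [/\ expo q r = expo u r,
    q.1 - u.1 = 3 ^+ (M - expo u r) * r.1 & q.2 - u.2 = 3 ^+ (M - expo u r) * r.2].
  by rewrite -muq; apply: apex_outer_right => //; rewrite muq ?(bounded_root bE) // ltnW.
have s0 : (0 < M - expo u r)%N by rewrite subn_gt0.
have c1 := dvd3_scaled s0 d1; have c2 := dvd3_scaled s0 d2.
have [||||ltx x1 x2] := @hexagon_ear_left u q z gu gq gz euq euz ezq _ _ c1 c2 x gx eux exz.
all: try by rewrite ?muq ?muz ?mzq ?(bounded_root bA) ?(bounded_root bB).
have [||||lty y1 y2] := @hexagon_ear_right u q z gu gq gz euq euz ezq _ _ c1 c2 y gy ezy eyq.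
all: try by rewrite ?muq ?muz ?mzq ?(bounded_root bC) ?(bounded_root bD).
have [exy mxy /(_ _ s0)[/(_ d1 d2) [exr eyr nxr nyr] _]] :=
  hexagon_edges r euq ltx lty x1 x2 y1 y2.
rewrite /b1 /b /= eur gx vA exr gy exy gz vB vC eyr gq vD vE.
(* With s = M - [expo u r], the root label goes from s to i - (i + 1 - s) = s - 1, where i =
   [expo u x]. *)
split=> //; last by rewrite /apex_label nqr muq; clear -nxr lt; lia.
(* The inner edges of the hexagon weigh 3 M before the exchange and 2 i + 2 j + 3 - M - 2 s after
   it, where i, j < M and s > 0. *)
by rewrite muq muz mzq; clear -nxr nyr ltx lty mxy muq lt; lia.
Qed.

Lemma hexagon_move_right M r p v z x y A B C D E :
  let b := Tri p E (Tri z (Tri x A B) (Tri y C D)) in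
  let b1 := Tri y (Tri x (Tri p E A) (Tri z B C)) D in
  prim_vec r -> prim_vec v -> valid r v b -> bounded M r v b ->
  expo p v = M -> expo p z = M -> expo z v = M -> (expo r v < M)%N ->
  [/\ valid r v b1, (weight r v b1 < weight r v b)%N &
      root_apex_label r v b1 = root_apex_label r v b + 1].
Proof.
move=> b b1 gr gv /=.
case/and4P=> erv gp vE /and4P[epv gz vl vr].
case/and4P: vl => epz gx vA vB; case/and4P: vr => ezv gy vC vD.
case/and3P=> _ bE /and3P[_ bl br] mpv mpz mzv lt.
case/and3P: bl => _ bA bB; case/and3P: br => _ bC bD.
have epx := valid_edge vA; have exz := valid_edge vB.
have ezy := valid_edge vC; have eyv := valid_edge vD; have erp := valid_edge vE.
have [nrp d1 d2] : [/\ expo r p = expo r v,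
    p.1 - v.1 = 3 ^+ (M - expo r v) * r.1 & p.2 - v.2 = 3 ^+ (M - expo r v) * r.2].
  by rewrite -mpv; apply: apex_outer_left => //; rewrite mpv ?(bounded_root bE) // ltnW.
have s0 : (0 < M - expo r v)%N by rewrite subn_gt0.
have c1 := dvdzBC (dvd3_scaled s0 d1); have c2 := dvdzBC (dvd3_scaled s0 d2).
have [||||ltx x1 x2] := @hexagon_ear_left p v z gp gv gz epv epz ezv _ _ c1 c2 x gx epx exz.
all: try by rewrite ?mpv ?mpz ?mzv ?(bounded_root bA) ?(bounded_root bB).
have [||||lty y1 y2] := @hexagon_ear_right p v z gp gv gz epv epz ezv _ _ c1 c2 y gy ezy eyv.
all: try by rewrite ?mpv ?mpz ?mzv ?(bounded_root bC) ?(bounded_root bD).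
have [exy mxy /(_ _ s0)[_ /(_ d1 d2) [erx ery nrx nry]]] :=
  hexagon_edges r epv ltx lty x1 x2 y1 y2.
rewrite /b1 /b /= erv gy ery gx erx gp vE vA exy gz vB vC vD.
split=> //; last by rewrite /apex_label nrp mpv; clear -nry lt; lia.
by rewrite mpv mpz mzv; clear -nrx nry ltx lty mxy mpv lt; lia.
Qed.

(** Descend through edges below M. At the first triangle with a lower edge of exponent M, the
    difference of the ends of that edge is divisible by 3, so a hexagon lies around the triangle
    below it. Only an exchange at the root can change the root label. *)
Lemma bounded_pred_or_move M u v b :
  valid u v b -> bounded M u v b -> (expo u v < M)%N -> sides_lt M u v b ->
  prim_vec u -> prim_vec v ->
  bounded M.-1 u v b \/
  exists b1, [/\ valid u v b1, inorder b1 = inorder b,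
    (weight u v b1 < weight u v b)%N &
    `|root_apex_label u v b1 - root_apex_label u v b| <= 1].
Proof.
elim: b u v => [|w l IHl r IHr] u v vb bb lt sb gu gv.
  by left; rewrite /= andbT; lia.
have /= /and4P[euv gw vl vr] := vb; have /= /and3P[_ bl br] := bb.
have /= /andP[sl sr] := sb.
have [muw|nuw] := eqVneq (expo u w) M.
  right; case: l {IHl} vb bb vl bl {sb} sl => [|z l1 l2] vb bb vl bl sl.
    by move: sl; rewrite /= muw ltnn.
  have /= /and4P[euw gz vl1 vl2] := vl; have /= /and3P[_ bl1 bl2] := bl.
  have [_ d1 d2] : [/\ expo w v = expo u v,
      w.1 - u.1 = 3 ^+ (M - expo u v) * v.1 & w.2 - u.2 = 3 ^+ (M - expo u v) * v.2].
    rewrite -muw; apply: apex_outer_right; rewrite ?muw ?(bounded_root br) 1?ltnW //.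
    exact: valid_edge vr.
  have s0 : (0 < M - expo u v)%N by rewrite subn_gt0.
  have [||muz mzw _ _] := @hexagon_center u w z gu gw gz euw (valid_edge vl1)
    (valid_edge vl2) _ _ (dvd3_scaled s0 d1) (dvd3_scaled s0 d2).
  1,2: by rewrite muw ?(bounded_root bl1) ?(bounded_root bl2).
  move: sl; rewrite muw in muz mzw.
  (* Both lower edges have exponent M, so neither is a side of the polygon and both ears exist. *)
  case: l1 {vl1 bl1} vb bb vl bl => [|x A B]; first by rewrite /= muz ltnn.
  case: l2 {vl2 bl2} => [|y C D]; first by rewrite /= mzw ltnn andbF.
  move=> vb bb vl bl _.
  have [v1 w1 l1] := hexagon_move_left gu gv vb bb muw muz mzw lt.
  exists (Tri x A (Tri y (Tri z B C) (Tri w D r))); split=> //.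
    by rewrite /= -!catA /= -!catA.
  by rewrite l1 addrC addKr.
have [mwv|nwv] := eqVneq (expo w v) M.
  right; case: r {IHr} vb bb vr br {sb} sr => [|z l1 l2] vb bb vr br sr.
    by move: sr; rewrite /= mwv ltnn.
  have /= /and4P[ewv gz vl1 vl2] := vr; have /= /and3P[_ bl1 bl2] := br.
  have [_ d1 d2] : [/\ expo u w = expo u v,
      w.1 - v.1 = 3 ^+ (M - expo u v) * u.1 & w.2 - v.2 = 3 ^+ (M - expo u v) * u.2].
    rewrite -mwv; apply: apex_outer_left; rewrite ?mwv ?(bounded_root bl) 1?ltnW //.
    exact: valid_edge vl.
  have s0 : (0 < M - expo u v)%N by rewrite subn_gt0.
  have [||mwz mzv _ _] := @hexagon_center w v z gw gv gz ewv (valid_edge vl1)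
    (valid_edge vl2) _ _ (dvdzBC (dvd3_scaled s0 d1)) (dvdzBC (dvd3_scaled s0 d2)).
  1,2: by rewrite mwv ?(bounded_root bl1) ?(bounded_root bl2).
  move: sr; rewrite mwv in mwz mzv.
  case: l1 {vl1 bl1} vb bb vr br => [|x A B]; first by rewrite /= mwz ltnn.
  case: l2 {vl2 bl2} => [|y C D]; first by rewrite /= mzv ltnn andbF.
  move=> vb bb vr br _.
  have [v1 w1 l1] := hexagon_move_right gu gv vb bb mwv mwz mzv lt.
  exists (Tri y (Tri x (Tri w l A) (Tri z B C)) D); split=> //.
    by rewrite /= -!catA /= -!catA.
  by rewrite l1 addrC addKr.
have ltl : (expo u w < M)%N by rewrite ltn_neqAle nuw (bounded_root bl).
have ltr : (expo w v < M)%N by rewrite ltn_neqAle nwv (bounded_root br).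
have [bl'|[l1 [v1 i1 w1 _]]] := IHl u w vl bl ltl sl gu gw; last first.
  right; exists (Tri w l1 r); split; rewrite /= ?euv ?gw ?v1 ?i1 ?subrr //.
  by rewrite ltn_add2l ltn_add2r.
have [br'|[r1 [v1 i1 w1 _]]] := IHr w v vr br ltr sr gw gv; last first.
  right; exists (Tri w l r1); split; rewrite /= ?euv ?gw ?vl ?v1 ?i1 ?subrr //.
  by rewrite !ltn_add2l.
by left; rewrite /= bl' br' !andbT -ltnS (ltn_predK lt).
Qed.

(** * Cutting and gluing along a side *)

Lemma cat_cons_split (T : Type) (l1 l2 l r : seq T) (w : T) :
  l ++ w :: r = l1 ++ l2 ->
  (exists2 c, l = l1 ++ c & l2 = c ++ w :: r) \/
  (exists2 d, l1 = l ++ w :: d & r = d ++ l2).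
Proof.
elim: l1 l => [|x l1 IH] [|y l] /=; first by move=> <-; left; exists [::].
- by move=> <-; left; exists (y :: l).
- by case=> <- ->; right; exists l1.
case=> -> /IH[[c -> ->]|[d -> ->]]; first by left; exists c.
by right; exists d.
Qed.

Lemma graft b u v l1 l2 S :
  valid u v b -> inorder b = l1 ++ l2 -> valid (last u l1) (head v l2) S ->
  exists b1, [/\ valid u v b1, inorder b1 = l1 ++ inorder S ++ l2 &
    b <> Side -> root_apex_label u v b1 = root_apex_label u v b].
Proof.
elim: b u v l1 l2 => [|w l IHl r IHr] u v l1 l2 /=.
  move=> _ e; have [-> ->] : l1 = [::] /\ l2 = [::] by case: l1 l2 e => [|? ?] [].
  by move=> vS; exists S; rewrite cats0.
case/and4P=> euv gw vl vr e; case: (cat_cons_split e) => [[c el ->]|[d -> er]] vS.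
  have vS' : valid (last u l1) (head w c) S by case: (c) vS.
  have [b1 [v1 i1 _]] := IHl _ _ _ _ vl el vS'.
  exists (Tri w b1 r); split=> //=; first by rewrite euv gw v1 vr.
  by rewrite i1 -!catA.
rewrite last_cat /= in vS; have [b1 [v1 i1 _]] := IHr _ _ _ _ vr er vS.
exists (Tri w l b1); split=> //=; first by rewrite euv gw v1 vl.
by rewrite i1 -!catA.
Qed.

(* G consists of the triangle of b on the side from [last u l1] to            *)
(* [head v l2] and of everything below the other lower side of that triangle; *)
(* b0 is what remains of b.                                                   *)
Lemma cut_side b u v l1 l2 : b <> Side ->
  valid u v b -> inorder b = l1 ++ l2 ->
  exists l1' l2' b0 G,
  [/\ valid u v b0, inorder b0 = l1' ++ l2',
      valid (last u l1') (head v l2') G,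
      l1 ++ l2 = l1' ++ inorder G ++ l2' &
      forall M, bounded M u v b ->
        bounded M u v b0 && bounded M (last u l1') (head v l2') G] /\
  [/\ (weight u v b0 <= weight u v b)%N,
      root_apex_label u v b =
        (if b0 is Side then root_apex_label u v G else root_apex_label u v b0) &
      (exists S, l1' = l1 /\ G = Tri (head v l2) Side S) \/
      (exists S, l2' = l2 /\ G = Tri (last u l1) S Side)].
Proof.
elim: b u v l1 l2 => // w l IHl r IHr u v l1 l2 _ vb.
have /= /and4P[euv gw vl vr] := vb.
move=> /= e; case: (cat_cons_split e) => {e} [[c el ->]|[d -> er]].
  case: l {vb} IHl vl el => [|z l1t l2t] IHl vl el.
    have [-> ->] : l1 = [::] /\ c = [::] by case: l1 c el => [|? ?] [].
    (* The side belongs to the root triangle, so everything is cut off. *)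
    exists [::], [::], Side, (Tri w Side r) => /=.
    rewrite cats0 euv gw vr (valid_edge vl); split; split=> //.
    - by move=> M /and3P[-> /andP[-> _] ->].
    - by rewrite leq_add2l.
    by left; exists r.
  have [//|l1' [l2' [b0 [G [[v0 i0 vG eG bG] [w0 r0 sG]]]]]] :=
    IHl u w l1 c _ vl el.
  have hd t : head v (t ++ w :: inorder r) = head w t by case: t.
  exists l1', (l2' ++ w :: inorder r), (Tri w b0 r), G; rewrite !hd.
  split; split=> //=; rewrite ?euv ?gw ?v0 ?vr ?i0 -?catA //.
  - by rewrite catA eG -!catA.
  - by move=> M /and3P[-> /bG /andP[-> ->] ->].
  - by rewrite leq_add2l leq_add2r.
  case: sG => [[S [-> ->]]|[S [-> ->]]]; first by left; exists S.
  by right; exists S.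
rewrite last_cat /=.
case: r {vb} IHr vr er => [|z l1t l2t] IHr vr er.
  have [-> ->] : d = [::] /\ l2 = [::] by case: d l2 er => [|? ?] [].
  exists [::], [::], Side, (Tri w l Side) => /=.
  rewrite !cats0 euv gw vl (valid_edge vr); split; split=> //.
  - by move=> M /and3P[-> -> /andP[-> _]].
  - by rewrite leq_add2l.
  by right; exists l.
have [//|l1' [l2' [b0 [G [[v0 i0 vG eG bG] [w0 r0 sG]]]]]] :=
  IHr w v d l2 _ vr er.
exists (inorder l ++ w :: l1'), l2', (Tri w l b0), G; rewrite !last_cat /=.
split; split=> //=; rewrite ?euv ?gw ?v0 ?vl ?i0 -?catA //.
- by rewrite /= eG.
- by move=> M /and3P[-> -> /bG /andP[-> ->]].
- by rewrite !leq_add2l.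
case: sG => [[S [-> ->]]|[S [-> ->]]]; first by left; exists S.
by right; exists S.
Qed.

Lemma valid_prim u v b : valid u v b -> all prim_vec (inorder b).
Proof.
elim: b u v => //= w l IHl r IHr u v /and4P[_ gw /IHl hl /IHr hr].
by rewrite all_cat /= hl gw hr.
Qed.

Lemma side_max M u v b : bounded M u v b -> ~~ sides_lt M u v b ->
  exists l1 l2, inorder b = l1 ++ l2 /\ expo (last u l1) (head v l2) = M.
Proof.
elim: b u v => [|w l IHl r IHr] u v /=.
  by rewrite andbT -leqNgt => h1 h2; exists [::], [::]; split=> //=; lia.
case/and3P=> _ bl br; rewrite negb_and => /orP[/(IHl _ _ bl)|/(IHr _ _ br)].
  move=> [l1 [l2 [-> e]]]; exists l1, (l2 ++ w :: inorder r); rewrite -catA.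
  by split=> //; rewrite -e; case: (l2).
move=> [l1 [l2 [-> e]]]; exists (inorder l ++ w :: l1), l2; rewrite -catA.
by rewrite last_cat.
Qed.

Lemma bounded_leq M M' u v b :
  (M <= M')%N -> bounded M u v b -> bounded M' u v b.
Proof.
move=> le; elim: b u v => [|w l IHl r IHr] u v /=.
  by rewrite !andbT => h; apply: leq_trans le.
by case/and3P=> h /IHl -> /IHr ->; rewrite (leq_trans h le).
Qed.

Lemma bounded_weight u v b : bounded (weight u v b) u v b.
Proof.
elim: b u v => [|w l IHl r IHr] u v /=; first by rewrite addn0 leqnn.
by rewrite leq_addr !(bounded_leq _ (IHl _ _)) ?(bounded_leq _ (IHr _ _)) //; lia.
Qed.

Lemma uniq_cat_inj (T : eqType) (r : T) (s s' t t' : seq T) :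
  uniq (s ++ r :: t) -> s ++ r :: t = s' ++ r :: t' -> s = s' /\ t = t'.
Proof.
move=> us e; have us' := us; rewrite e in us'.
have ix (a c : seq T) : uniq (a ++ r :: c) -> index r (a ++ r :: c) = size a.
  rewrite cat_uniq /= negb_or => /and3P[_ /andP[rn _] _].
  by rewrite index_cat (negPf rn) /= eqxx addn0.
have sz : size s = size s' by rewrite -(ix _ _ us) e (ix _ _ us').
move/eqP: e; rewrite eqseq_cat // => /andP[/eqP -> /eqP[->]].
by [].
Qed.

(** Two opposite nonzero vectors cannot both have nonnegative coordinates; this decides at which end
    of a maximal side the third vertex lies. *)
Lemma prim_vec_opp_neq x y r r' i j : prim_vec r -> prim_vec r' ->
  y.1 - x.1 = 3 ^+ i * r.1 -> y.2 - x.2 = 3 ^+ i * r.2 ->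
  x.1 - y.1 = 3 ^+ j * r'.1 -> x.2 - y.2 = 3 ^+ j * r'.2 -> False.
Proof.
move=> gr gr' e1 e2 e3 e4.
have pos k (a : int) : 0 <= a -> 0 <= 3 ^+ k * a.
  by move=> a0; rewrite mulr_ge0 // exprn_ge0.
have/and3P[r1 r2 _] := gr; have/and3P[r1' r2' _] := gr'.
have z1 : 3 ^+ i * r.1 = 0.
  have := pos i _ r1; have := pos j _ r1'; rewrite -e1 -e3.
  by move: (x.1) (y.1) => a b; lia.
have z2 : 3 ^+ i * r.2 = 0.
  have := pos i _ r2; have := pos j _ r2'; rewrite -e2 -e4.
  by move: (x.2) (y.2) => a b; lia.
move/eqP: z1; rewrite mulf_eq0 (negPf (expr3_neq0 i)) /= => /eqP z1.
move/eqP: z2; rewrite mulf_eq0 (negPf (expr3_neq0 i)) /= => /eqP z2.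
by apply: (prim_vec_not3 gr); rewrite ?z1 ?z2 dvdz0.
Qed.

Lemma all_last (T : eqType) (P : pred T) x s : P x -> all P s -> P (last x s).
Proof.
move=> Px /allP Ps; have := mem_last x s; rewrite inE => /orP[/eqP ->//|].
exact: Ps.
Qed.

Lemma all_head (T : Type) (P : pred T) x s : P x -> all P s -> P (head x s).
Proof. by case: s => //= y s _ /andP[]. Qed.

Lemma inorder_Side b : inorder b = [::] -> b = Side.
Proof. by case: b => //= w l r; case: (inorder l). Qed.

Lemma rcons_head (T : Type) (x : T) s : rcons s x = head x s :: behead (rcons s x).
Proof. by case: s. Qed.

(** The place of a cut is recovered from its end vertex. Appending v makes the default value of
    [head] a genuine entry. *)
Lemma uniq_suffix_eq (v : vec) s s' l l' : uniq (rcons (s ++ l) v) ->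
  s ++ l = s' ++ l' -> head v l = head v l' -> s = s' /\ l = l'.
Proof.
move=> us e eh.
have e1 : s ++ rcons l v = s' ++ rcons l' v by rewrite -!rcons_cat e.
rewrite rcons_cat rcons_head in us; rewrite (rcons_head v l) (rcons_head v l') in e1.
rewrite eh in us e1; have [-> et] := uniq_cat_inj us e1; split=> //.
have : rcons l v = rcons l' v by rewrite rcons_head eh et -rcons_head.
by case/rcons_inj.
Qed.

Lemma uniq_prefix_eq (u : vec) s s' l l' : uniq (u :: l ++ s) ->
  l ++ s = l' ++ s' -> last u l = last u l' -> s = s' /\ l = l'.
Proof.
move=> us e eh.
have e1 : (u :: l) ++ s = (u :: l') ++ s' by rewrite /= e.
rewrite -cat_cons (lastI u l) cat_rcons in us.
rewrite (lastI u l) (lastI u l') !cat_rcons -eh in e1.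
have [et ->] := uniq_cat_inj us e1; split=> //.
have : u :: l = u :: l' by rewrite (lastI u l) et eh -lastI.
by case.
Qed.

(** The triangle on a maximal side (x, y) has third vertex proportional to y - x or x - y. Signs
    select the same case in both triangulations, so the vertices and hence the cuts coincide. *)
Lemma cut_common M u v b b' l1 l2 : prim_vec u -> prim_vec v ->
  valid u v b -> valid u v b' -> bounded M u v b -> bounded M u v b' ->
  b <> Side -> inorder b = l1 ++ l2 -> inorder b' = l1 ++ l2 ->
  uniq (u :: rcons (l1 ++ l2) v) -> expo (last u l1) (head v l2) = M ->
  exists l1' l2' b0 b0' G,
  [/\ valid u v b0, valid u v b0', inorder b0 = l1' ++ l2',
      inorder b0' = l1' ++ l2' & valid (last u l1') (head v l2') G] /\
  [/\ l1 ++ l2 = l1' ++ inorder G ++ l2' /\ inorder G <> [::],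
      (weight u v b0 <= weight u v b)%N, (weight u v b0' <= weight u v b')%N &
      if b0 is Side then root_apex_label u v b = root_apex_label u v b'
      else root_apex_label u v b0 = root_apex_label u v b /\
           root_apex_label u v b0' = root_apex_label u v b'].
Proof.
move=> gu gv vb vb' bb bb' nb i1 i1' ul eM.
have nb' : b' <> Side.
  by move=> e; case: nb; apply: inorder_Side; rewrite i1 -i1' e.
have al := valid_prim vb.
have al12 : all prim_vec l1 && all prim_vec l2 by rewrite -all_cat -i1.
case/andP: al12 => al1 al2.
have gx := all_last gu al1; have gy := all_head gv al2.
have [a1 [a2 [b0 [G [[v0 j0 vG eG bG] [w0 r0 sG]]]]]] := cut_side nb vb i1.
have [c1 [c2 [b0' [G' [[v0' j0' vG' eG' bG'] [w0' r0' sG']]]]]] := cut_side nb' vb' i1'.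
have/andP[_ {}bG] := bG _ bb; have/andP[_ {}bG'] := bG' _ bb'.
have ala := valid_prim v0; have alc := valid_prim v0'.
rewrite j0 all_cat in ala; rewrite j0' all_cat in alc.
case/andP: ala => ala1 ala2; case/andP: alc => alc1 alc2.
have ga1 := all_last gu ala1; have ga2 := all_head gv ala2.
have gc1 := all_last gu alc1; have gc2 := all_head gv alc2.
(* [G] and [G'] share their top triangle but may differ below it; only their root labels are
   compared, and [G] is the piece kept for gluing. *)
have [e1 e2 eR] : [/\ a1 = c1, a2 = c2 &
    root_apex_label u v G = root_apex_label u v G'].
  have outer_right r S : prim_vec r ->
      valid (last u l1) r (Tri (head v l2) Side S) ->
      bounded M (last u l1) r (Tri (head v l2) Side S) ->
      exists i, (head v l2).1 - (last u l1).1 = 3 ^+ i * r.1 /\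
                (head v l2).2 - (last u l1).2 = 3 ^+ i * r.2.
    move=> gr /= /and4P[exr _ /andP[exy _] vS] /and3P[mxr _ bS].
    have [||_ h1 h2] := apex_outer_right gx gy gr exy (valid_edge vS) exr.
    - by rewrite eM (bounded_root bS).
    - by rewrite eM.
    by exists (expo (last u l1) (head v l2) - expo (last u l1) r)%N.
  have outer_left r S : prim_vec r ->
      valid r (head v l2) (Tri (last u l1) S Side) ->
      bounded M r (head v l2) (Tri (last u l1) S Side) ->
      exists i, (last u l1).1 - (head v l2).1 = 3 ^+ i * r.1 /\
                (last u l1).2 - (head v l2).2 = 3 ^+ i * r.2.
    move=> gr /= /and4P[erx _ vS /andP[exy _]] /and3P[mrx bS _].
    have [||_ h1 h2] := apex_outer_left gr gx gy (valid_edge vS) exy erx.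
    - by rewrite eM (bounded_root bS).
    - by rewrite eM.
    by exists (expo (last u l1) (head v l2) - expo r (head v l2))%N.
  case: sG => [[S [ea eGS]]|[S [ea eGS]]]; case: sG' => [[S' [ec eGS']]|[S' [ec eGS']]].
  - rewrite ea eGS in vG bG eG; rewrite ec eGS' in vG' bG' eG'.
    have [i [h1 h2]] := outer_right _ _ ga2 vG bG.
    have [j [h1' h2']] := outer_right _ _ gc2 vG' bG'.
    have er : head v a2 = head v c2.
      apply: (prim_vec_scale_eq (i := i) (j := j)) => //.
        by rewrite -h1 -h1'.
      by rewrite -h2 -h2'.
    have us : uniq (rcons ((l1 ++ head v l2 :: inorder S) ++ a2) v).
      by move: ul; rewrite eG /= -catA => /andP[].
    have es : (l1 ++ head v l2 :: inorder S) ++ a2 =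
              (l1 ++ head v l2 :: inorder S') ++ c2.
      by rewrite -!catA /=; rewrite /= in eG eG'; rewrite -eG -eG'.
    by have [_ e2] := uniq_suffix_eq us es er; rewrite ea ec eGS eGS'.
  - rewrite ea eGS in vG bG; rewrite ec eGS' in vG' bG'.
    have [i [h1 h2]] := outer_right _ _ ga2 vG bG.
    have [j [h1' h2']] := outer_left _ _ gc1 vG' bG'.
    by case: (prim_vec_opp_neq ga2 gc1 h1 h2 h1' h2').
  - rewrite ea eGS in vG bG; rewrite ec eGS' in vG' bG'.
    have [i [h1 h2]] := outer_left _ _ ga1 vG bG.
    have [j [h1' h2']] := outer_right _ _ gc2 vG' bG'.
    by case: (prim_vec_opp_neq gc2 ga1 h1' h2' h1 h2).
  rewrite ea eGS in vG bG eG; rewrite ec eGS' in vG' bG' eG'.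
  have [i [h1 h2]] := outer_left _ _ ga1 vG bG.
  have [j [h1' h2']] := outer_left _ _ gc1 vG' bG'.
  have er : last u a1 = last u c1.
    apply: (prim_vec_scale_eq (i := i) (j := j)) => //.
      by rewrite -h1 -h1'.
    by rewrite -h2 -h2'.
  have us : uniq (u :: a1 ++ (inorder S ++ [:: last u l1] ++ l2)).
    move: ul; rewrite eG /= -!catA /= mem_rcons inE negb_or rcons_uniq.
    by case/and3P=> /andP[_ ->] _ ->.
  have es : a1 ++ (inorder S ++ [:: last u l1] ++ l2) =
            c1 ++ (inorder S' ++ [:: last u l1] ++ l2).
    by rewrite /= -!catA /= in eG eG'; rewrite /= -eG -eG'.
  by have [_ e2] := uniq_prefix_eq us es er; rewrite ea ec eGS eGS'.
exists a1, a2, b0, b0', G; split; split=> //.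
- by rewrite j0' e1 e2.
- by split=> //; case: sG => [[S [_ ->]]|[S [_ ->]]] //=; case: (inorder S).
case: b0 {w0 v0} r0 j0 => [|w l r] r0 j0.
  have e : b0' = Side by apply: inorder_Side; rewrite j0' -e1 -e2 -j0.
  by rewrite e in r0'; rewrite r0 r0'.
rewrite r0; case: b0' r0' j0' {w0' v0'} => // _ j0'.
by move: j0; rewrite e1 e2 -j0' /=; case: (inorder l).
Qed.

Lemma labels_between n u v b b' k :
  (weight u v b + weight u v b' + size (inorder b) <= n)%N ->
  prim_vec u -> prim_vec v -> valid u v b -> valid u v b' ->
  inorder b = inorder b' -> b <> Side -> uniq (u :: rcons (inorder b) v) ->
  (root_apex_label u v b <= k <= root_apex_label u v b') ||
  (root_apex_label u v b' <= k <= root_apex_label u v b) ->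
  exists b2, [/\ valid u v b2, inorder b2 = inorder b & root_apex_label u v b2 = k].
Proof.
elim: n b b' => [|n IH] b b'.
  case: b => // w l r; rewrite leqn0 addn_eq0 => /andP[_].
  by rewrite /= size_cat /= addnS.
move=> le gu gv vb vb' ii nb ul hk.
have exM : exists M, bounded M u v b && bounded M u v b'.
  exists (weight u v b + weight u v b')%N.
  by rewrite !(bounded_leq _ (bounded_weight _ _ _)) ?leq_addr ?leq_addl.
(* M is the largest exponent occurring in either triangulation. *)
case: (ex_minnP exM) => M /andP[bb bb'] minM.
have same : root_apex_label u v b = root_apex_label u v b' ->
    exists b2, [/\ valid u v b2, inorder b2 = inorder b & root_apex_label u v b2 = k].
  by move=> e; exists b; split=> //; rewrite e in hk *; clear -hk; lia.
have cut l1 l2 : inorder b = l1 ++ l2 -> expo (last u l1) (head v l2) = M ->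
    exists b2, [/\ valid u v b2, inorder b2 = inorder b & root_apex_label u v b2 = k].
  move=> e eM; have ul' := ul; rewrite e in ul'.
  have [a1 [a2 [b0 [b0' [G [[v0 v0' i0 i0' vG] [[eG nG] w0 w0' hR]]]]]]] :=
    cut_common gu gv vb vb' bb bb' nb e (etrans (esym ii) e) ul' eM.
  case: b0 v0 i0 w0 hR => [|w l r] v0 i0 w0; first exact: same.
  case=> hb hb'.
  have [|||||b2 [v2 i2 r2]] := IH _ b0' _ gu gv v0 v0'.
  - have sG : (0 < size (inorder G))%N by case: (inorder G) nG.
    by move: le; rewrite i0 e eG !size_cat; clear -w0 w0' sG; lia.
  - by rewrite i0 i0'.
  - by [].
  - apply: subseq_uniq ul; rewrite e eG i0 /= eqxx -!cats1 -!catA.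
    by rewrite cat_subseq ?subseq_refl // suffix_subseq.
  - by rewrite hb hb'.
  rewrite i0 in i2; have [b3 [v3 i3 r3]] := graft v2 i2 vG.
  exists b3; rewrite i3 e eG; split=> //; rewrite r3 //.
  by move=> e2; rewrite e2 -i0 /= in i2; case: (inorder l) i2.
have [eM|ltM] := eqVneq (expo u v) M.
  case: b b' vb vb' bb bb' ii nb same {cut le minM exM ul hk} => [|w l r] // [|w' l' r'].
    by move=> _ _ _ _ /=; case: (inorder l).
  move=> /and4P[euv gw vl vr] /and4P[_ gw' vl' vr'].
  move=> /and3P[_ bl br] /and3P[_ bl' br'] _ _; apply.
  have [||_ h1 h2] := apex_inner gu gw gv (valid_edge vl) (valid_edge vr) euv.
  1,2: by rewrite eM ?(bounded_root bl) ?(bounded_root br).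
  have [||_ h1' h2'] := apex_inner gu gw' gv (valid_edge vl') (valid_edge vr') euv.
  1,2: by rewrite eM ?(bounded_root bl') ?(bounded_root br').
  rewrite /= (prim_vec_scale_eq gw gw' (etrans (esym h1) h1') (etrans (esym h2) h2')).
  by [].
have {}ltM : (expo u v < M)%N by rewrite ltn_neqAle ltM (bounded_root bb).
have [sb|/(side_max bb)[l1 [l2 [e eM]]]] := boolP (sides_lt M u v b); last first.
  exact: cut e eM.
have [sb'|/(side_max bb')[l1 [l2 [e eM]]]] := boolP (sides_lt M u v b'); last first.
  by apply: cut eM; rewrite ii.
have [lb|[b1 [v1 i1 w1 r1]]] := bounded_pred_or_move vb bb ltM sb gu gv; last first.
  have nb1 : b1 <> Side.
    by move=> e; case: nb; apply: inorder_Side; rewrite -i1 e.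
  (* Unless k is already attained, a change of the label by at most 1 cannot jump over k. *)
  have [->|nk] := eqVneq k (root_apex_label u v b); first by exists b.
  rewrite -i1; apply: (IH b1 b') => //; rewrite ?i1 //.
    by rewrite -ltnS (leq_trans _ le) // !ltn_add2r.
  by clear -r1 hk nk; lia.
have [lb'|[b1 [v1 i1 w1 r1]]] := bounded_pred_or_move vb' bb' ltM sb' gu gv; last first.
  have [->|nk] := eqVneq k (root_apex_label u v b'); first by exists b'.
  apply: (IH b b1) => //; rewrite ?i1 //.
    by rewrite -ltnS (leq_trans _ le) // ltn_add2r ltn_add2l.
  by clear -r1 hk nk; lia.
(* No exchange is possible in either triangulation, so M - 1 bounds both, against minimality. *)
have := minM M.-1; rewrite lb lb' => /(_ isT).
by clear -ltM; lia.
Qed.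

(** * Subdivision trees as triangulations *)

(** This is u + 3^m v, cleared of denominators when m is negative. *)
Definition mediant (m : int) (u v : vec) : vec :=
  match m with
  | Posz k => (u.1 + 3 ^+ k * v.1, u.2 + 3 ^+ k * v.2)
  | Negz k => (3 ^+ k.+1 * u.1 + v.1, 3 ^+ k.+1 * u.2 + v.2)
  end.

Definition reduce (w : vec) : vec :=
  let g := gcdz w.1 w.2 in ((w.1 %/ g)%Z, (w.2 %/ g)%Z).

Definition apex (m : int) (u v : vec) : vec := reduce (mediant m u v).

(* The parameter z records the parametrization [proj_map u v (3 ^ z)], below, *)
(* of the interval between u and v; labels are relative to it.                *)
Fixpoint tree_of (z : int) (u v : vec) b : subdivision_tree :=
  if b is Tri w l r then
    Node (apex_label u w v - z)
      (tree_of ((expo u v)%:Z - (expo w v)%:Z) u w l)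
      (tree_of ((expo u w)%:Z - (expo u v)%:Z) w v r)
  else Leaf.

Fixpoint triangulation_of (z : int) (u v : vec) T : triangulation :=
  if T is Node n l r then
    let w := apex (z + n) u v in
    Tri w (triangulation_of ((expo u v)%:Z - (expo w v)%:Z) u w l)
      (triangulation_of ((expo u w)%:Z - (expo u v)%:Z) w v r)
  else Side.

Lemma reduceE w : 0 <= w.1 -> 0 <= w.2 -> gcdz w.1 w.2 != 0 ->
  [/\ prim_vec (reduce w), w.1 = gcdz w.1 w.2 * (reduce w).1 &
      w.2 = gcdz w.1 w.2 * (reduce w).2].
Proof.
move=> w1 w2 g0; rewrite /reduce /=; set g := gcdz w.1 w.2 in g0 *.
have d1 : (g %| w.1)%Z by rewrite dvdz_gcdl.
have d2 : (g %| w.2)%Z by rewrite dvdz_gcdr.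
have e1 : w.1 = g * (w.1 %/ g)%Z by rewrite mulrC divzK.
have e2 : w.2 = g * (w.2 %/ g)%Z by rewrite mulrC divzK.
have gp : 0 < g by rewrite lt_neqAle eq_sym g0.
split=> //; apply/and3P; split=> /=; rewrite ?divz_ge0 //.
apply/eqP/(mulfI g0); rewrite mulr1 -{4}[g]gez0_abs ?ltW //.
by rewrite -[LHS]/(g * _) -{1}[g]gez0_abs ?ltW // mulz_gcdr -e1 -e2 gez0_abs ?ltW.
Qed.

Lemma dvdz_expr3 (g x : int) k : 0 <= g -> g * x = 3 ^+ k ->
  exists j, g = 3 ^+ j.
Proof.
move=> g0 e; have : (`|g| %| 3 ^ k)%N.
  by have /(congr1 absz) := e; rewrite abszM abszX => <-; apply: dvdn_mulr.
case/(dvdn_pfactor _ _ (isT : prime 3)) => j _ ej; exists j.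
by rewrite -[LHS]gez0_abs // ej -natz natrX.
Qed.

(** The gcd divided out of the mediant divides its determinant with u, a power of 3, so it is itself
    a power of 3 and cancels in the difference of exponents. *)
Lemma apexP m u v : prim_vec u -> prim_vec v -> edge u v ->
  let w := apex m u v in
  [/\ prim_vec w, edge u w, edge w v & apex_label u w v = m].
Proof.
move=> gu gv euv; have duv := det_edge euv.
have /and3P[u1 u2 _] := gu; have /and3P[v1 v2 _] := gv.
set W := mediant m u v.
have pos k (a b : int) : 0 <= a -> 0 <= b -> 0 <= 3 ^+ k * a + b.
  by move=> a0 b0; rewrite addr_ge0 // mulr_ge0 // exprn_ge0.
have [W1 W2] : 0 <= W.1 /\ 0 <= W.2.
  by rewrite /W; case: (m) => k /=; split; rewrite 1?[u.1 + _]addrC 1?[u.2 + _]addrC pos.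
have [i [j [eW1 eW2 eij]]] : exists i j : nat,
    [/\ det u W = 3 ^+ (expo u v + i), det W v = 3 ^+ (expo u v + j) &
        i%:Z - j%:Z = m].
  rewrite /W; case: (m) => k /=.
    by exists k, 0%N; split; rewrite ?subr0 // exprD -duv /det /=; ring.
  exists 0%N, k.+1; rewrite NegzE sub0r; split=> //;
    by rewrite exprD -duv /det /=; ring.
have g0 : gcdz W.1 W.2 != 0.
  apply/negP; rewrite gcdz_eq0 => /andP[/eqP z1 /eqP z2].
  move/eqP: eW1; rewrite /det z1 z2 !mul0r subrr eq_sym.
  by rewrite (negPf (expr3_neq0 _)).
have [gw e1 e2] := reduceE W1 W2 g0; rewrite -/(apex m u v) in gw e1 e2 *.
set w := apex m u v in gw e1 e2 *; set g := gcdz _ _ in g0 e1 e2.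
have f1 : g * det u w = 3 ^+ (expo u v + i) by rewrite -eW1 /det e1 e2; ring.
have f2 : g * det w v = 3 ^+ (expo u v + j) by rewrite -eW2 /det e1 e2; ring.
have [h eg] := dvdz_expr3 (isT : 0 <= g) f1.
rewrite eg in f1 f2; have [l1 {}f1] := expr3_cancel f1.
have [l2 {}f2] := expr3_cancel f2.
split=> //; [exact: edge_det f1|exact: edge_det f2|].
rewrite /apex_label (expo_edge f1) (expo_edge f2) -eij; clear -l1 l2; lia.
Qed.

Lemma triangulation_of_valid z u v T : prim_vec u -> prim_vec v -> edge u v ->
  valid u v (triangulation_of z u v T).
Proof.
elim: T z u v => [|n l IHl r IHr] z u v gu gv euv /=; first by rewrite euv.
have [gw euw ewv _] := apexP (z + n) gu gv euv.
by rewrite euv gw IHl // IHr.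
Qed.

Lemma triangulation_ofK z u v T : prim_vec u -> prim_vec v -> edge u v ->
  tree_of z u v (triangulation_of z u v T) = T.
Proof.
elim: T z u v => [|n l IHl r IHr] z u v gu gv euv //=.
have [gw euw ewv e] := apexP (z + n) gu gv euv.
by rewrite e IHl // IHr // addrC addKr.
Qed.

(** * Realization on [0, 1) *)

Section Realization.
Variable R : realType.
Implicit Types (u v w : vec) (x y lam mu : R).

Lemma mapA_I01 x : I01 R x -> I01 R (mapA x).
Proof.
move=> /= /andP[x0 x1]; have d0 : 0 < x + 1 by lra.
by rewrite /I01 /mapA /= divr_ge0 ?ltr_pdivrMr //; lra.
Qed.

Lemma mapB_I01 x : I01 R x -> I01 R (mapB x).
Proof.
move=> /= /andP[x0 x1]; have d0 : 0 < 2 - x by lra.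
by rewrite /I01 /mapB /= divr_ge0 ?ltr_pdivrMr //; lra.
Qed.

Lemma mapCpow_I01 n x : I01 R x -> I01 R (mapCpow n x).
Proof.
move=> Ix; case: n => k; first by elim: k => [//|k IH]; exact: mapC_I01 IH.
by elim: k => [|k IH]; [exact: mapCinv_I01 Ix | exact: mapCinv_I01 IH].
Qed.

Lemma word_map_I01 (wd : word) x : I01 R x -> I01 R (word_map wd x).
Proof.
move=> Ix; elim: wd => [//|[n []] wd IH] /=; apply: mapCpow_I01.
  exact: mapA_I01.
exact: mapB_I01.
Qed.

(** * Word maps as projective maps *)

Definition point u : R := u.1%:~R / (u.1 + u.2)%:~R.

(* The projective map with columns lam v and u, in the coordinate x that      *)
(* stands for the vector (x, 1 - x).                                          *)
Definition proj_map u v lam x : R :=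
  (x * lam * v.1%:~R + (1 - x) * u.1%:~R) /
  (x * lam * (v.1 + v.2)%:~R + (1 - x) * (u.1 + u.2)%:~R).

Lemma prim_vec_sum u : prim_vec u -> 0 < (u.1 + u.2)%:~R :> R.
Proof.
case/and3P=> u1 u2 cop; rewrite ltr0z lt_neqAle addr_ge0 // andbT eq_sym.
rewrite paddr_eq0 //; apply/negP=> /andP[/eqP z1 /eqP z2].
by move: cop; rewrite z1 z2.
Qed.

Lemma ratio_scale (n d n' d' t : R) : t != 0 ->
  n' = n * t -> d' = d * t -> n' / d' = n / d.
Proof. by move=> t0 -> ->; rewrite -mulf_div divff // mulr1. Qed.

Lemma proj_mapC u v lam x : I01 R x ->
  proj_map u v lam (mapC x) = proj_map u v (lam * 3) x.
Proof.
move=> /= /andP[x0 x1]; have d0 : 2 * x + 1 != 0 by apply/eqP; lra.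
by apply: (ratio_scale (t := (2 * x + 1)^-1)); rewrite ?invr_eq0 // /mapC; field.
Qed.

Lemma proj_mapCinv u v lam x : I01 R x ->
  proj_map u v lam (mapCinv x) = proj_map u v (lam / 3) x.
Proof.
move=> /= /andP[x0 x1]; have d0 : 3 - 2 * x != 0 by apply/eqP; lra.
by apply: (ratio_scale (t := 3 / (3 - 2 * x)));
  rewrite ?mulf_neq0 ?invr_eq0 ?pnatr_eq0 // /mapCinv; field.
Qed.

Lemma proj_mapCpow u v lam n x : I01 R x ->
  proj_map u v lam (mapCpow n x) = proj_map u v (lam * 3 ^ n) x.
Proof.
case: n => k Ix.
  rewrite -exprnP; elim: k lam => [|k IH] lam; first by rewrite mulr1.
  rewrite [mapCpow _ _]/(mapC (mapCpow k x)) proj_mapC; last exact: mapCpow_I01.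
  by rewrite IH exprS mulrA.
rewrite -[3 ^ _]/(3 ^- k.+1); elim: k lam => [|k IH] lam.
  by rewrite [mapCpow _ _]/(mapCinv x) proj_mapCinv.
rewrite [mapCpow _ _]/(mapCinv (mapCpow (Negz k) x)) proj_mapCinv;
  last exact: mapCpow_I01.
by rewrite IH [in RHS]exprS invfM mulrA.
Qed.

Section Apex.
Variables (u w v : vec) (lam mu : R).
Hypotheses (mu0 : mu != 0).
Hypothesis e1 : u.1%:~R + lam * v.1%:~R = mu * w.1%:~R.
Hypothesis e2 : u.2%:~R + lam * v.2%:~R = mu * w.2%:~R.

(** For t = x / (1 - x), u + lam t / (t + 1) v is proportional to u + t (u + lam v) = u + t mu w.
    For [mapB], u + lam (t + 1) v = mu (w + (lam / mu) t v). *)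
Lemma proj_mapA x : I01 R x -> proj_map u v lam (mapA x) = proj_map u w mu x.
Proof.
move=> /= /andP[x0 x1]; have d0 : x + 1 != 0 by apply/eqP; lra.
apply: (ratio_scale (t := (x + 1)^-1)); rewrite ?invr_eq0 // /mapA.
  by rewrite -[x * mu * _]mulrA -e1; field.
rewrite -[x * mu * _]mulrA !intrD [mu * _]mulrDr -e1 -e2; field.
exact: d0.
Qed.

Lemma proj_mapB x : I01 R x ->
  proj_map u v lam (mapB x) = proj_map w v (lam / mu) x.
Proof.
move=> /= /andP[x0 x1]; have d0 : 2 - x != 0 by apply/eqP; lra.
have f1 : w.1%:~R = (u.1%:~R + lam * v.1%:~R) / mu by rewrite e1 [mu * _]mulrC mulfK.
have f2 : w.2%:~R = (u.2%:~R + lam * v.2%:~R) / mu by rewrite e2 [mu * _]mulrC mulfK.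
apply: (ratio_scale (t := mu / (2 - x))); rewrite ?mulf_neq0 ?invr_eq0 // /mapB.
  by rewrite f1; field; rewrite mu0 d0.
by rewrite !intrD f1 f2; field; rewrite mu0 d0.
Qed.

End Apex.

Lemma proj_map_image u v lam : prim_vec u -> prim_vec v -> edge u v -> 0 < lam ->
  proj_map u v lam @` I01 R = [set y | point u <= y < point v].
Proof.
move=> gu gv euv l0.
have su := prim_vec_sum gu; have sv := prim_vec_sum gv.
have dt : 0 < v.1%:~R * (u.1 + u.2)%:~R - u.1%:~R * (v.1 + v.2)%:~R :> R.
  rewrite -!intrM -intrB ltr0z (_ : _ - _ = det u v); last by rewrite /det; ring.
  by rewrite (det_edge euv) expr3_gt0.
move: su sv dt; rewrite /point /proj_map.
move: (u.1%:~R) (v.1%:~R) ((u.1 + u.2)%:~R) ((v.1 + v.2)%:~R) => a b c d c0 d0 dt.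
apply/seteqP; split=> [_ [x /andP[x0 x1] <-]|y /= /andP[y0 y1]] /=.
  have D0 : 0 < x * lam * d + (1 - x) * c.
    by rewrite ltr_wpDl ?mulr_ge0 ?mulr_gt0 ?subr_gt0 // ltW.
  apply/andP; split.
    rewrite ler_pdivrMr // mulrAC ler_pdivlMr //.
    have : 0 <= x * lam * (b * c - a * d) by rewrite !mulr_ge0 // ltW.
    by lra.
  rewrite ltr_pdivrMr // [b / d * _]mulrAC ltr_pdivlMr //.
  have : 0 < (1 - x) * (b * c - a * d) by rewrite mulr_gt0 // subr_gt0.
  by lra.
rewrite ler_pdivrMr // in y0; rewrite ltr_pdivlMr // in y1.
have p0 : 0 <= y * c - a by rewrite subr_ge0.
have q0 : 0 < lam * (b - y * d) by rewrite mulr_gt0 // subr_gt0.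
set p := y * c - a in p0; set q := lam * (b - y * d) in q0.
have pq : 0 < p + q by rewrite ltr_wpDl.
(* x solves p (1 - x) = q x, which is linear in x. *)
exists (p / (p + q)).
  rewrite /I01 /= (divr_ge0 p0 (ltW pq)) /=.
  by rewrite ltr_pdivrMr // mul1r ltrDl.
rewrite (_ : 1 - p / (p + q) = q / (p + q)); last first.
  by rewrite -[X in X - _](divff (lt0r_neq0 pq)) -mulrBl addrAC subrr add0r.
have D0 : 0 < p * lam * d + q * c.
  exact: ltr_wpDl (mulr_ge0 (mulr_ge0 p0 (ltW l0)) (ltW d0)) (mulr_gt0 q0 c0).
rewrite (@ratio_scale (p * lam * b + q * a) (p * lam * d + q * c) _ _ (p + q)^-1).
- by apply: (canLR (mulfK (lt0r_neq0 D0))); rewrite /p /q; ring.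
- by rewrite invr_eq0 lt0r_neq0.
- by ring.
by ring.
Qed.

(** * Intervals of a tree as sides of a polygon *)

Definition sides u (l : seq vec) v : seq (vec * vec) := zip (u :: l) (rcons l v).

Lemma sides_cat u l1 w l2 v :
  sides u (l1 ++ w :: l2) v = sides u l1 w ++ sides w l2 v.
Proof.
rewrite /sides rcons_cat rcons_cons -(cat_rcons w l1 (rcons l2 v)) -cat_cons.
by rewrite zip_cat ?size_rcons.
Qed.

(** This is [cramer] divided by 3^([expo w v]); the exponents of mu and lam / mu are the parameters
    that [tree_of] hands to the two subtrees. *)
Lemma apex_relation u w v : edge u w -> edge w v -> edge u v ->
  let lam := (3 : R) ^ (apex_label u w v) in
  let mu := (3 : R) ^ ((expo u v)%:Z - (expo w v)%:Z) in
  [/\ u.1%:~R + lam * v.1%:~R = mu * w.1%:~R,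
      u.2%:~R + lam * v.2%:~R = mu * w.2%:~R &
      lam / mu = 3 ^ ((expo u w)%:Z - (expo u v)%:Z)].
Proof.
move=> euw ewv euv lam mu.
have n0 k : (3 : R) ^+ k != 0 by rewrite expf_neq0 // pnatr_eq0.
have E i j : (3 : R) ^ (i%:Z - j%:Z) = 3 ^+ i / 3 ^+ j.
  by rewrite expfzDr ?pnatr_eq0 // -exprnP -exprnN.
have cr i : det u v * i w = det w v * i u + det u w * i v ->
    (i u)%:~R + lam * (i v)%:~R = mu * (i w)%:~R :> R.
  rewrite (det_edge euw) (det_edge ewv) (det_edge euv).
  move/(congr1 (fun z : int => z%:~R : R)).
  rewrite /lam /mu /apex_label !E intrD !intrM !rmorphXn /= => h.
  by rewrite [RHS]mulrAC h mulrDl [X in _ = X + _]mulrAC divff // mul1r mulrAC.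
have [c1 c2] := cramer u w v; split; [exact: (cr fst)|exact: (cr snd)|].
rewrite /lam /mu /apex_label !E invf_div mulrA mulfVK //.
Qed.

Lemma intervals_tree_of b z u v J : prim_vec u -> prim_vec v -> valid u v b ->
  (exists2 wd, wd \in leaf_labels (tree_of z u v b) &
     J = (proj_map u v (3 ^ z) \o word_map wd) @` I01 R) <->
  (exists2 p, p \in sides u (inorder b) v & J = [set y | point p.1 <= y < point p.2]).
Proof.
elim: b z u v => [|w l IHl r IHr] z u v gu gv /=.
  rewrite andbT => euv; have im := proj_map_image gu gv euv (exprz_gt0 z (ltr0n R 3)).
  split=> [[wd]|[p]]; rewrite inE => /eqP -> ->.
    by exists (u, v); [rewrite inE | exact: im].
  by exists [::]; [rewrite inE | exact: esym im].
case/and4P=> euv gw vl vr.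
have [e1 e2 e3] := apex_relation (valid_edge vl) (valid_edge vr) euv.
set lam := 3 ^ apex_label u w v in e1 e2 e3.
set mu := 3 ^ ((expo u v)%:Z - (expo w v)%:Z) in e1 e2 e3.
have mu0 : mu != 0 by rewrite expfz_neq0 // pnatr_eq0.
have el : 3 ^ z * 3 ^ (apex_label u w v - z) = lam.
  by rewrite -expfzDr ?pnatr_eq0 // addrC subrK.
have imA wd : (proj_map u v (3 ^ z) \o
      word_map ((apex_label u w v - z, true) :: wd)) @` I01 R =
    (proj_map u w mu \o word_map wd) @` I01 R.
  apply: eq_imagel => x Ix /=; have Iw := word_map_I01 wd Ix.
  by rewrite proj_mapCpow ?el; [exact: proj_mapA | exact: mapA_I01].
have imB wd : (proj_map u v (3 ^ z) \o
      word_map ((apex_label u w v - z, false) :: wd)) @` I01 R =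
    (proj_map w v (lam / mu) \o word_map wd) @` I01 R.
  apply: eq_imagel => x Ix /=; have Iw := word_map_I01 wd Ix.
  by rewrite proj_mapCpow ?el; [exact: proj_mapB | exact: mapB_I01].
have [l1 l2] := IHl ((expo u v)%:Z - (expo w v)%:Z) _ _ gu gw vl.
have [r1 r2] := IHr ((expo u w)%:Z - (expo u v)%:Z) _ _ gw gv vr.
rewrite sides_cat; split=> [[wd]|[p]]; rewrite mem_cat => /orP[].
- case/mapP=> wd' hwd -> eJ; rewrite imA in eJ.
  by have [|p hp e] := l1; [exists wd' | exists p; rewrite // mem_cat hp].
- case/mapP=> wd' hwd -> eJ; rewrite imB e3 in eJ.
  by have [|p hp e] := r1; [exists wd' | exists p; rewrite // mem_cat hp orbT].
- move=> hp eJ; have [|wd hwd e] := l2; first by exists p.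
  exists ((apex_label u w v - z, true) :: wd); last by rewrite imA.
  by rewrite mem_cat map_f.
move=> hp eJ; have [|wd hwd e] := r2; first by exists p.
exists ((apex_label u w v - z, false) :: wd); last by rewrite imB e3.
by rewrite mem_cat orbC map_f.
Qed.

Lemma point_lt u v : prim_vec u -> prim_vec v -> edge u v -> point u < point v.
Proof.
move=> gu gv euv; have su := prim_vec_sum gu; have sv := prim_vec_sum gv.
rewrite /point ltr_pdivrMr // mulrAC ltr_pdivlMr // -!intrM ltr_int -subr_gt0.
rewrite (_ : _ - _ = det u v); last by rewrite /det; ring.
by rewrite (det_edge euv) expr3_gt0.
Qed.

Lemma point_sorted u v b : prim_vec u -> prim_vec v -> valid u v b ->
  path <%R (point u) (map point (rcons (inorder b) v)).
Proof.
elim: b u v => [|w l IHl r IHr] u v gu gv /=.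
  by rewrite !andbT => /(point_lt gu gv).
case/and4P=> _ gw vl vr; rewrite rcons_cat rcons_cons -cat_rcons map_cat cat_path.
by rewrite IHl // last_map last_rcons IHr.
Qed.

Lemma point_inj u v : prim_vec u -> prim_vec v -> point u = point v -> u = v.
Proof.
move=> gu gv /eqP; have su := prim_vec_sum gu; have sv := prim_vec_sum gv.
rewrite /point eqr_div ?lt0r_neq0 // -!intrM eqr_int => /eqP e.
have {}e : u.1 * v.2 = v.1 * u.2 by clear -e; lia.
case/and3P: gu => u1 u2 cu; case/and3P: gv => v1 v2 cv.
have antisym (a b : int) : 0 <= a -> 0 <= b -> (a %| b)%Z -> (b %| a)%Z -> a = b.
  move=> a0 b0 ab ba; rewrite -[a]gez0_abs // -[b]gez0_abs //; congr Posz.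
  by apply/eqP; rewrite eqn_dvd; apply/andP.
rewrite (surjective_pairing u) (surjective_pairing v); congr (_, _).
  apply: antisym => //.
    by rewrite -(Gauss_dvdzl _ cu) -e dvdz_mulr.
  by rewrite -(Gauss_dvdzl _ cv) e dvdz_mulr.
apply: antisym => //.
  by rewrite -(@Gauss_dvdzr _ u.1) 1?coprimez_sym // e dvdz_mull.
by rewrite -(@Gauss_dvdzr _ v.1) 1?coprimez_sym // -e dvdz_mull.
Qed.

Lemma map_point_inj (l l' : seq vec) : all prim_vec l -> all prim_vec l' ->
  map point l = map point l' -> l = l'.
Proof.
elim: l l' => [|x l IH] [|y l'] //= /andP[gx al] /andP[gy al'] [e el].
by rewrite (point_inj gx gy e) (IH l').
Qed.

Lemma interval_left_inj (a b c d : R) : a < b ->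
  [set y | a <= y < b] = [set y | c <= y < d] -> a = c.
Proof.
move=> ab e.
have /andP[ca ad] : [set y | c <= y < d] a by rewrite -e /= lexx.
have /andP[ac _] : [set y | a <= y < b] c by rewrite e /= lexx (le_lt_trans ca).
by apply/eqP; rewrite eq_le ac ca.
Qed.

Definition vec0 : vec := (0, 1).
Definition vec_oo : vec := (1, 0).

Lemma prim_vec0 : prim_vec vec0. Proof. by []. Qed.
Lemma prim_vec_oo : prim_vec vec_oo. Proof. by []. Qed.
Lemma edge_0oo : edge vec0 vec_oo. Proof. by []. Qed.

Lemma proj_map_id x : proj_map vec0 vec_oo (3 ^ (0 : int)) x = x.
Proof.
rewrite /proj_map /vec0 /vec_oo expr0z !(addr0, add0r) !mulr1 mulr0 addr0.
by rewrite addrC subrK divr1.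
Qed.

Lemma intervals_sides b : valid vec0 vec_oo b ->
  @intervals R (tree_of 0 vec0 vec_oo b) =
  [set J | exists2 p, p \in sides vec0 (inorder b) vec_oo &
             J = [set y | point p.1 <= y < point p.2]].
Proof.
move=> vb; apply/funext => J; apply/propext.
have := intervals_tree_of 0 J prim_vec0 prim_vec_oo vb.
have -> : proj_map vec0 vec_oo (3 ^ (0 : int)) = id.
  by apply/funext => x; exact: proj_map_id.
by [].
Qed.

Lemma mem_sides u l v (x : vec) : x \in u :: l -> exists y : vec, (x, y) \in sides u l v.
Proof.
move=> xl; have : x \in unzip1 (sides u l v).
  by rewrite unzip1_zip // size_rcons.
by case/mapP=> -[x' y] h /= ->; exists y.
Qed.

Lemma sides_point_lt u l v p : path <%R (point u) (map point (rcons l v)) ->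
  p \in sides u l v -> point p.1 < point p.2.
Proof.
elim: l u => [|w l IH] u /=.
  by rewrite andbT => h; rewrite inE => /eqP ->.
by case/andP=> h hp; rewrite inE => /orP[/eqP ->//|]; exact: IH.
Qed.

(** The collection of intervals determines the set of left endpoints; these increase strictly along
    the vertex list, so the set determines the list. *)
Lemma tree_equiv_inorder b b' : valid vec0 vec_oo b -> valid vec0 vec_oo b' ->
  tree_equiv R (tree_of 0 vec0 vec_oo b) (tree_of 0 vec0 vec_oo b') <->
  inorder b = inorder b'.
Proof.
move=> vb vb'; rewrite /tree_equiv !intervals_sides //; split=> [e|-> //].
have sub c c' : valid vec0 vec_oo c -> valid vec0 vec_oo c' ->
    [set J | exists2 p, p \in sides vec0 (inorder c) vec_oo &
             J = [set y | point p.1 <= y < point p.2]] =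
    [set J | exists2 p, p \in sides vec0 (inorder c') vec_oo &
             J = [set y | point p.1 <= y < point p.2]] ->
    {subset map point (vec0 :: inorder c) <= map point (vec0 :: inorder c')}.
  move=> vc vc' ec a /mapP[x xc ->]; have [y xy] := mem_sides vec_oo xc.
  have lt := sides_point_lt (point_sorted prim_vec0 prim_vec_oo vc) xy.
  have : [set J | exists2 p, p \in sides vec0 (inorder c) vec_oo &
             J = [set y | point p.1 <= y < point p.2]] [set t | point x <= t < point y].
    by exists (x, y).
  rewrite ec => -[[x' y'] h' /(interval_left_inj lt) ->].
  apply: map_f; have := map_f fst h'.
  by rewrite -/(unzip1 _) unzip1_zip // size_rcons.
have srt c : valid vec0 vec_oo c -> sorted <%R (map point (vec0 :: inorder c)).
  move=> /(point_sorted prim_vec0 prim_vec_oo) /=.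
  by rewrite map_rcons rcons_path => /andP[].
have : map point (vec0 :: inorder b) = map point (vec0 :: inorder b').
  apply: lt_sorted_eq; [exact: srt|exact: srt|move=> a].
  by apply/idP/idP; [exact: sub e a | exact: sub (esym e) a].
move=> /= [] /map_point_inj; apply; [exact: valid_prim vb|exact: valid_prim vb'].
Qed.

Lemma inorder_uniq b : valid vec0 vec_oo b ->
  uniq (vec0 :: rcons (inorder b) vec_oo).
Proof.
move=> /(point_sorted prim_vec0 prim_vec_oo) h.
by apply: (@map_uniq _ _ point); apply: lt_sorted_uniq.
Qed.

(** By [triangulation_ofK] every tree is [tree_of] a valid triangulation, so ranging over equivalent
    trees is ranging over triangulations of one polygon. *)
Lemma root_labelsE b : valid vec0 vec_oo b -> b <> Side ->
  root_labels R (tree_of 0 vec0 vec_oo b) =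
  [set k | exists b', [/\ valid vec0 vec_oo b', inorder b' = inorder b &
                          root_apex_label vec0 vec_oo b' = k]].
Proof.
move=> vb nb; apply/seteqP; split=> k /=.
  case=> T [eT rT]; pose b' := triangulation_of 0 vec0 vec_oo T.
  have vb' := triangulation_of_valid 0 T prim_vec0 prim_vec_oo edge_0oo.
  have eb' := triangulation_ofK 0 T prim_vec0 prim_vec_oo edge_0oo.
  rewrite -/b' in vb' eb'; rewrite -eb' in eT rT; exists b'; split=> //.
    exact/tree_equiv_inorder.
  by case: b' rT {vb' eb' eT} => //= w l r [<-]; rewrite subr0.
case=> b' [vb' ib' <-]; exists (tree_of 0 vec0 vec_oo b'); split.
  exact/tree_equiv_inorder.
case: b' ib' {vb'} => [|w l r] ib' /=; last by rewrite subr0.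
by case: nb; apply: inorder_Side; rewrite -ib'.
Qed.

End Realization.

(** * Extreme labels and conclusion *)

Lemma int_seq_min (s : seq int) : s != [::] ->
  exists2 m, m \in s & forall k, k \in s -> m <= k.
Proof.
elim: s => // x [|y s] IH _; first by exists x; rewrite ?inE // => k; rewrite inE => /eqP ->.
have [//|m ms hm] := IH; have [xm|mx] := leP x m.
  exists x; first by rewrite inE eqxx.
  by move=> k; rewrite inE => /orP[/eqP -> //|/hm]; exact: le_trans.
exists m; first by rewrite inE ms orbT.
by move=> k; rewrite inE => /orP[/eqP -> |/hm //]; exact: ltW.
Qed.

Lemma int_set_bounds (S : set int) (s : seq int) k0 :
  S k0 -> (forall k, S k -> k \in s) ->
  exists m M, [/\ S m, S M & forall k, S k -> m <= k <= M].
Proof.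
move=> Sk0 Ss; pose t := [seq k <- s | `[< S k >]].
have tP k : k \in t <-> S k.
  rewrite mem_filter; split=> [/andP[/asboolP //]|Sk].
  by rewrite (Ss _ Sk) andbT; apply/asboolP.
have t0 : t != [::] by apply/eqP => e; have /tP := Sk0; rewrite e.
have [m mt hm] := int_seq_min t0.
have t0' : map -%R t != [::] by case: (t) t0.
have [M /mapP[M' Mt ->] hM] := int_seq_min t0'.
exists m, M'; split; [exact/tP|exact/tP|].
move=> k /tP kt; rewrite hm //=; have := hM (- k) (map_f _ kt).
by rewrite lerN2.
Qed.

Theorem theorem8p11 (R : realType) (T : subdivision_tree) (hT : T <> Leaf) :
  exists m M : int,
    [/\ root_labels R T m /\ lbound (root_labels R T) m,
        root_labels R T M /\ ubound (root_labels R T) M &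
        root_labels R T = [set k : int | m <= k <= M]].
Proof.
have vb := triangulation_of_valid 0 T prim_vec0 prim_vec_oo edge_0oo.
have eT := triangulation_ofK 0 T prim_vec0 prim_vec_oo edge_0oo.
set b := triangulation_of _ _ _ _ in vb eT.
have nb : b <> Side by move=> e; apply: hT; rewrite -eT e.
rewrite -eT root_labelsE //; set S := [set k | _].
(* The root apex is one of the division points, which gives a finite list of candidate labels. *)
have [||m [M [Sm SM hS]]] :=
  @int_set_bounds S [seq apex_label vec0 w vec_oo | w <- inorder b]
    (root_apex_label vec0 vec_oo b).
- by exists b.
- move=> k [b' [vb' ib' <-]]; case: b' ib' {vb'} => [|w l r] ib' /=.
    by case: nb; apply: inorder_Side; rewrite -ib'.
  apply: (map_f (fun w => apex_label vec0 w vec_oo)).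
  by rewrite -ib' /= mem_cat inE eqxx orbT.
exists m, M; split.
- by split=> // k /hS /andP[].
- by split=> // k /hS /andP[].
apply/seteqP; split=> [k /hS //|k /= hk].
case: Sm => b1 [v1 i1 e1]; case: SM => b2 [v2 i2 e2].
have nb1 : b1 <> Side.
  by move=> e; apply: nb; apply: inorder_Side; rewrite -i1 e.
have [|b3 [v3 i3 e3]] := labels_between (k := k) (leqnn _) prim_vec0 prim_vec_oo
    v1 v2 (etrans i1 (esym i2)) nb1 (inorder_uniq R v1).
  by rewrite e1 e2 hk.
by exists b3; rewrite i3 i1.
Qed.
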